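(* Let $X=\{0,1\}^{\mathbb{N}}\subseteq\mathbb{Z}^{\mathbb{N}}$, and let $G=\langle X\rangle$ be the subgroup of $\mathbb{Z}^{\mathbb{N}}$ generated by $X$. Then $G$ is $\sigma$-compact (in particular, it is Hurewicz-bounded) but is not Rothberger-bounded.
   Context: The group $\mathbb{Z}^{\mathbb{N}}$ carries pointwise addition and the product topology ($\mathbb{Z}$ discrete); subgroups carry the subspace topology. $\sigma$-compact means a union of countably many compact sets. A topological group $(G,\cdot)$ is Hurewicz-bounded if for each sequence $(U_n)_{n\in\mathbb{N}}$ of neighborhoods of the unit there exist finite $F_n\subseteq G$ such that each $g\in G$ belongs to $F_n\cdot U_n$ for all but finitely many $n$; it is Rothberger-bounded if for each such sequence there exist $a_n\in G$, $n\in\mathbb{N}$, such that $G=\bigcup_n a_n\cdot U_n$. Here $A\cdot B=\{a\cdot b:a\in A,\ b\in B\}$ and $a\cdot B=\{a\cdot b:b\in B\}$. *)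

(* Defs.v *)
From HB Require Import structures.
From mathcomp Require Import all_boot all_order all_algebra.
From mathcomp Require Import all_classical all_reals all_analysis.

Set Implicit Arguments.
Unset Strict Implicit.
Unset Printing Implicit Defensive.

Import Order.TTheory GRing.Theory Num.Theory.

Local Open Scope classical_set_scope.
Local Open Scope ring_scope.

Definition sigma_compact (T : topologicalType) (A : set T) :=
  exists K : nat -> set T,
    (forall n, compact (K n)) /\ A = \bigcup_n K n.

(* The groups at hand are abelian, so boundedness is written additively:
   A + U stands for the product set A . U, and 0 for the unit. *)
Definition hurewicz_bounded (G : topologicalZmodType) :=
  forall U : nat -> set G, (forall n, nbhs 0 (U n)) ->
  exists F : nat -> set G, (forall n, finite_set (F n)) /\
    forall g : G,
      \forall n \near \oo, [set a + u | a in F n & u in U n] g.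

Definition rothberger_bounded (G : topologicalZmodType) :=
  forall U : nat -> set G, (forall n, nbhs 0 (U n)) ->
  exists a : nat -> G, [set: G] = \bigcup_n [set a n + u | u in U n].

Definition subgroup (M : zmodType) (H : set M) := zmod_closed [in H].

(* The intersection of all subgroups of M that contain X. *)
Definition gen_set (M : zmodType) (X : set M) : set M :=
  smallest (@subgroup M) X.

Section generated_zmodType.
Context (M : zmodType) (X : set M).

Definition gen_pred : {pred M} := [in gen_set X].

Lemma gen_pred_zmod_closed : zmod_closed gen_pred.
Proof.
split=> [|x y].
  by rewrite inE => H [[H0 _] _]; rewrite inE in H0.
rewrite !inE => gx gy H HX; have [[_ HB] _] := HX.
by have := HB x y; rewrite !inE; apply; [exact: gx|exact: gy].
Qed.

HB.instance Definition _ :=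
  GRing.isZmodClosed.Build M gen_pred gen_pred_zmod_closed.

Definition generated : Type := {x : M | x \in gen_pred}.

HB.instance Definition _ := SubChoice.on generated.
HB.instance Definition _ := [SubChoice_isSubZmodule of generated by <:].

End generated_zmodType.

Section generated_topologicalZmodType.
Context (M : topologicalZmodType) (X : set M).

(* The subspace topology, as the initial topology of the inclusion in M. *)
HB.instance Definition _ := Topological.copy (generated X)
  (initial_topology (val : generated X -> M)).

Lemma generated_sub_continuous :
  continuous (fun x : generated X * generated X => x.1 - x.2).
Proof.
move=> [x y] A [_ [[B oB <-] Bxy sBA]].
have nB : nbhs (val x - val y) B by exact: open_nbhs_nbhs.
have [[P Q] [/= nP nQ] sPQ] := @sub_continuous M (val x, val y) _ nB.
have cv (z : generated X) : val @ z --> val z by exact: initial_continuous.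
exists (val @^-1` P, val @^-1` Q) => /=; first by split; exact: cv.
by move=> [a b] [/= Pa Qb]; apply: sBA; exact: (sPQ (val a, val b)).
Qed.

HB.instance Definition _ := PreTopologicalNmodule_isTopologicalZmodule.Build
  (generated X) generated_sub_continuous.

End generated_topologicalZmodType.

Lemma cvg_ptws (I : Type) (K : I -> topologicalType)
    (F : set_system (prod_topology K)) (f : prod_topology K) :
  Filter F -> (forall i, (fun g : prod_topology K => g i) @ F --> f i) ->
  F --> f.
Proof.
move=> FF Ff; apply/cvg_sup => i A [_ [[B oB <-] Bf sBA]].
by apply: filterS sBA _; apply: (Ff i); exact: open_nbhs_nbhs.
Qed.

(* The additive group Z^N with the product topology; pointwise addition comes
   from the function type, and int alone carries no topology. *)
Definition int_seq : Type := {ptws nat -> discrete_topology int}.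

HB.instance Definition _ :=
  Topological.copy int_seq {ptws nat -> discrete_topology int}.
HB.instance Definition _ := GRing.Zmodule.copy int_seq (nat -> int).

Lemma int_seq_sub_continuous :
  continuous (fun x : int_seq * int_seq => x.1 - x.2).
Proof.
move=> [x y]; rewrite /continuous_at; set l := (X in _ --> X).
have FF := @fmap_filter _ _ (fun z : int_seq * int_seq => z.1 - z.2) _
  (nbhs_filter ((x, y) : int_seq * int_seq)).
have := @cvg_ptws nat (fun=> discrete_topology int) _ l FF.
apply => i; apply/discrete_cvg.
have cv (z : int_seq) : nbhs z [set t : int_seq | t i = z i].
  exact: (@proj_continuous nat (fun=> discrete_topology int) i z _
    (@discrete_set1 (discrete_topology int) (z i))).
exists ([set t | t i = x i], [set t | t i = y i]); first by split; exact: cv.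
by move=> [a b] [/= ai bi]; rewrite /= [LHS]/(a i - b i) ai bi.
Qed.

HB.instance Definition _ := PreTopologicalNmodule_isTopologicalZmodule.Build
  int_seq int_seq_sub_continuous.

(* Main.v *)
(** The group generated by a compact set X is the union over n of the sets of
    sums of n differences of elements of X or 0; these are continuous images
    of finite powers of a compact set, so the group is sigma-compact.
    Finitely many translates of U_n cover the union of the first n compact
    sets, which gives Hurewicz-boundedness.  Rothberger-boundedness fails by
    diagonalization: with U_n the elements that vanish at n, no translate
    a_n + U_n contains the 0-1 sequence x with x(n) <> a_n(n) for all n. *)
Require Import Defs.
From HB Require Import structures.
From mathcomp Require Import all_boot all_order all_algebra.
From mathcomp Require Import all_classical all_reals all_analysis.

Set Implicit Arguments.
Unset Strict Implicit.
Unset Printing Implicit Defensive.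

Import Order.TTheory GRing.Theory Num.Theory.

Local Open Scope classical_set_scope.
Local Open Scope ring_scope.

Lemma compactB (G : topologicalZmodType) (A B : set G) :
  compact A -> compact B -> compact [set x - y | x in A & y in B].
Proof.
move=> cA cB; rewrite (image2E _ _ (fun x y => x - y)).
apply: continuous_compact (compact_setX cA cB).
apply: continuous_subspaceT.
have -> : uncurry (fun x y : G => x - y) = (fun z : G * G => z.1 - z.2).
  by apply/funext => -[].
exact: sub_continuous.
Qed.

(** Continuity of subtraction at [(x, x)], with the second argument then frozen at [x]. *)
Lemma near_subr (G : topologicalZmodType) (U : set G) (x : G) :
  nbhs 0 U -> \forall y \near x, U (y - x).
Proof.
move=> U0.
have /= := @sub_continuous G (x, x) U; rewrite /= subrr => /(_ U0).
move=> [[P Q] [/= nP nQ] sPQ].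
apply: filterS nP => y Py; apply: (sPQ (y, x)); split => //=.
exact: nbhs_singleton.
Qed.

Lemma compact_finite_translates (G : topologicalZmodType) (K U : set G) :
  compact K -> nbhs 0 U ->
  exists2 F : set G, finite_set F & K `<=` [set a + u | a in F & u in U].
Proof.
move=> /compact_near_coveringP cK U0.
(* A property holds near [supsets] when it holds for all sets containing some finite set. The
   near-covering form of compactness along this filter thus yields one finite set of translation
   points for all of [K]. *)
pose supsets := filter_from finite_set (fun S : set G => [set S' | S `<=` S']).
have Fsup : Filter supsets.
  apply: filter_from_filter; first by exists set0; exact: finite_set0.
  move=> S T fS fT; exists (S `|` T); first by rewrite finite_setU.
  by move=> S'; rewrite /= subUset.
have [] := cK _ supsets
    (fun (S : set G) x => [set a + u | a in S & u in U] x) Fsup.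
  move=> x _; exists ([set y | U (y - x)], [set S | S x]).
    split; first exact: near_subr.
    by exists [set x] => [|S /=]; [exact: finite_set1|rewrite sub1set inE].
  move=> [y S] [/= Uyx Sx]; exists x => //; exists (y - x) => //.
  by rewrite addrC subrK.
by move=> F fF sF; exists F => //; exact: (sF F).
Qed.

Lemma sigma_compact_hurewicz_bounded (G : topologicalZmodType) :
  sigma_compact [set: G] -> hurewicz_bounded G.
Proof.
move=> [K [cK KT]] U U0.
(* The bound [n.+1] puts [K n] itself into [L n], so a point of [K m] lies in [L n] for every [n] at
   least [m]. *)
pose L n := \big[setU/set0]_(i < n.+1) K i.
have cL n : compact (L n) by apply: bigsetU_compact => i _.
have /choice[F FP] : forall n, exists F : set G,
    finite_set F /\ L n `<=` [set a + u | a in F & u in U n].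
  by move=> n; have [F] := compact_finite_translates (cL n) (U0 n); exists F.
exists F; split=> [n|g]; first by case: (FP n).
have [m _ Kmg] : (\bigcup_n K n) g by rewrite -KT.
exists m => // n /= mn; apply: (FP n).2.
by rewrite /L -bigcup_mkord; exists m.
Qed.

Lemma val_generated (M : zmodType) (X : set M) (x : M) :
  X x -> exists g : generated X, val g = x.
Proof.
move=> Xx; have gx : x \in gen_pred X by rewrite inE; exact: sub_gen_smallest.
by exists (Sub x gx); rewrite SubK.
Qed.

(** The image filter clusters at a point of [X], which lifts to the generated group; since the
    topology there is initial for [val], the lift is a cluster point too. *)
Lemma compact_preimage_val (M : topologicalZmodType) (X : set M) :
  compact X -> compact [set g : generated X | X (val g)].
Proof.
move=> cX F FF FX.
have [x [Xx clx]] := cX (val @ F) _ FX.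
have [g gx] := val_generated Xx.
exists g; split; first by rewrite /mkset gx.
move=> A B FA [_ [[V oV <-] Vg sVB]].
have [| |_ [[a Aa <-] Va]] := clx [set val (h : generated X) | h in A] V.
- by apply: (@filterS _ F) FA => a Aa; exists a.
- by apply: open_nbhs_nbhs; split=> //; rewrite -gx.
by exists a; split=> //; exact: sVB.
Qed.

(** The differences of [C] form a symmetric set, which makes the union over [n] closed under
    subtraction; each stage uses subtraction alone, so [compactB] applies. *)
Fixpoint iter_diff (G : zmodType) (C : set G) (n : nat) : set G :=
  if n is n'.+1 then
    [set x - y | x in iter_diff C n' & y in [set a - b | a in C & b in C]]
  else [set 0].

Lemma compact_iter_diff (G : topologicalZmodType) (C : set G) n :
  compact C -> compact (iter_diff C n).
Proof.
move=> cC; elim: n => [|n IHn] /=; first exact: compact_set1.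
by apply: compactB => //; exact: compactB.
Qed.

Lemma iter_diffB (G : zmodType) (C : set G) m n x y :
  iter_diff C m x -> iter_diff C n y -> iter_diff C (m + n) (x - y).
Proof.
move=> Cx; elim: n y => [|n IHn] y /=; first by move=> ->; rewrite addn0 subr0.
move=> [z Cz [_ [a Ca [b Cb <-]] <-]]; rewrite addnS.
exists (x - z); first exact: IHn.
(* Here [y = z - (a - b)], hence [x - y = (x - z) - (b - a)]. *)
exists (b - a); first by exists b => //; exists a.
by rewrite !opprB -addrA [- z + _]addrC.
Qed.

Lemma gen_iter_diff (M : zmodType) (X : set M) (g : generated X) :
  exists n, iter_diff (0 |` [set h : generated X | X (val h)]) n g.
Proof.
set C := 0 |` _.
(* The union of the stages is pushed into [M], where minimality of the generated subgroup
   applies. *)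
pose S := [set x : M | exists2 h : generated X,
  val h = x & exists n, iter_diff C n h].
suff [h /val_inj ->] : S (val g) by [].
have := valP g; rewrite inE; apply: smallest_sub; last first.
  move=> x Xx; have [h hx] := val_generated Xx.
  exists h => //; exists 1%N => /=.
  (* Adjoining 0 to [C] pays off here: [h = 0 - (0 - h)] lies in the first stage. *)
  exists 0 => //; exists (0 - h); last by rewrite !sub0r opprK.
  by exists 0; [left|exists h => //; right; rewrite /mkset hx].
split=> [|x y]; rewrite !inE.
  by exists 0; [exact: raddf0|exists 0%N].
move=> [h <- [m Ch]] [k <- [n Ck]].
by exists (h - k); [exact: raddfB|exists (m + n)%N; exact: iter_diffB].
Qed.

Lemma sigma_compact_generated (M : topologicalZmodType) (X : set M) :
  compact X -> sigma_compact [set: generated X].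
Proof.
move=> cX; exists (iter_diff (0 |` [set h : generated X | X (val h)])).
split=> [n|].
  apply: compact_iter_diff; apply: compactU; first exact: compact_set1.
  exact: compact_preimage_val.
by apply/esym; rewrite -subTset => g _; have [n] := gen_iter_diff g; exists n.
Qed.

Lemma compact_01_int_seq :
  compact [set x : int_seq | forall n, (x n : int) = 0 \/ (x n : int) = 1].
Proof.
have c01 (n : nat) : compact [set k : discrete_topology int | k = 0 \/ k = 1].
  by apply: finite_compact; exact: finite_set2.
exact: tychonoff c01.
Qed.

(** The inclusion and the coordinate maps are continuous, and singletons are open in discrete
    [int]. *)
Lemma near_coord0 (X : set int_seq) (n : nat) :
  nbhs (0 : generated X) [set g : generated X | (val g : int_seq) n = 0 :> int].
Proof.
have cn := @proj_continuous nat (fun=> discrete_topology int) n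
  (val (0%R : generated X)) _ (@discrete_set1 (discrete_topology int) _).
have := @initial_continuous (generated X) int_seq val 0 _ cn.
apply: (@filterS (generated X) (nbhs 0)).
by move=> g gn; apply: (etrans gn); rewrite raddf0.
Qed.

Theorem theorem7p1 :
  let X : set int_seq :=
    [set x : int_seq | forall n : nat, (x n : int) = 0 \/ (x n : int) = 1] in
  sigma_compact [set: generated X] /\
  hurewicz_bounded (generated X) /\
  ~ rothberger_bounded (generated X).
Proof.
move=> X; have sG := sigma_compact_generated compact_01_int_seq.
split=> //; split; first exact: sigma_compact_hurewicz_bounded.
move=> rG.
pose U n := [set g : generated X | (val g : int_seq) n = 0 :> int].
have [a aT] := rG U (near_coord0 X).
pose d n : int := (val (a n) : int_seq) n.
(* The boolean is read as an integer: [x n] is 1 if [d n] is 0, and 0 otherwise, so [x] differs from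
   [d] everywhere. *)
pose x : int_seq := fun n => (d n == 0) : int.
have Xx : X x by move=> n; rewrite /x; case: eqP; [right|left].
have [g gx] := val_generated Xx.
have : [set: generated X] g by [].
rewrite aT => -[n _ [u Uu /(congr1 val)]]; rewrite raddfD gx.
move=> /(congr1 (fun f : int_seq => f n : int)) dux.
have {dux} : d n + (val u : int_seq) n = (d n == 0) :> int := dux.
rewrite [X in _ + X](Uu : (val u : int_seq) n = 0 :> int) [LHS]addr0.
by case: eqP => [->|].
Qed.
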